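(* Let $k\ge 2$ and let $G$ be the complete $k$-partite graph $K(4,2,\ldots,2)$ (one part of size $4$ and $k-1$ parts of size $2$). Then $h(G)=k$ if $k$ is odd and $h(G)=k+1$ if $k$ is even.
   Context: All graphs are finite and simple. A list assignment $L$ to a graph $G$ assigns a finite set $L(v)$ to each vertex $v$; a proper $L$-coloring is a map $\psi$ with $\psi(v)\in L(v)$ for all $v$ and $\psi(u)\ne\psi(v)$ for every edge $uv$. For a subgraph $H$ of $G$ and a color $\sigma$, let $H_\sigma$ denote the subgraph of $H$ induced by $\{v\in V(H):\sigma\in L(v)\}$, and let $\alpha$ denote the independence number (with $\alpha$ of the null graph equal to $0$). $G$ and $L$ satisfy Hall's condition if $\sum_{\sigma}\alpha(H_\sigma)\ge |V(H)|$ for every subgraph $H$ of $G$, the sum being over all colors. The Hall number $h(G)$ is the smallest positive integer $k$ such that $G$ has a proper $L$-coloring whenever $G$ and $L$ satisfy Hall's condition and $|L(v)|\ge k$ for every $v\in V(G)$. *)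

(* Defs.v *)
From mathcomp Require Import all_boot.
Set Implicit Arguments. Unset Strict Implicit. Unset Printing Implicit Defensive.

Section Hall.
Variable T : finType.

(* A simple graph on T is given by a symmetric irreflexive relation e. *)

Definition independent (F : rel T) (A : {set T}) : bool :=
  [forall x in A, forall y in A, ~~ F x y].

(* Independence number of the graph with vertex set S and edges F
   (0 for the null graph, since only the empty set is then available). *)
Definition alpha (S : {set T}) (F : rel T) : nat :=
  \max_(A : {set T} | (A \subset S) && independent F A) #|A|.

Definition subgraph (e : rel T) (S : {set T}) (F : rel T) : Prop :=
  forall x y, F x y -> [/\ x \in S, y \in S & e x y].

Variable C : finType.

Definition restrict (S : {set T}) (L : T -> {set C}) (sigma : C) : {set T} :=
  [set v in S | sigma \in L v].

Definition hall_condition (e : rel T) (L : T -> {set C}) : Prop :=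
  forall (S : {set T}) (F : rel T), subgraph e S F ->
    #|S| <= \sum_(sigma : C) alpha (restrict S L sigma) F.

Definition proper_L_coloring (e : rel T) (L : T -> {set C}) (psi : T -> C) : Prop :=
  (forall v, psi v \in L v) /\ (forall u v, e u v -> psi u != psi v).

End Hall.

Definition hall_property (T : finType) (e : rel T) (k : nat) : Prop :=
  forall (C : finType) (L : T -> {set C}),
    hall_condition e L -> (forall v, k <= #|L v|) ->
    exists psi : T -> C, proper_L_coloring e L psi.

Definition hall_number_is (T : finType) (e : rel T) (h : nat) : Prop :=
  [/\ 0 < h, hall_property e h &
      forall j, 0 < j -> j < h -> ~ hall_property e j].

Definition complete_multipartite (T : finType) (p : T -> nat) : rel T :=
  [rel u v | p u != p v].

(* K(4,2,...,2) with k parts: vertices 0..2k+1; vertices 0..3 form part 0,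
   vertices 4+2i, 5+2i form part i+1 (i = 0..k-2). *)
Definition K42_part (k : nat) (v : 'I_(2 * k + 2)) : nat :=
  if (v : nat) < 4 then 0 else ((v : nat) - 4)./2 + 1.

Definition K42 (k : nat) : rel 'I_(2 * k + 2) :=
  complete_multipartite (@K42_part k).

(* Main.v *)
Require Import Defs.
From mathcomp Require Import all_boot zify.
Set Implicit Arguments. Unset Strict Implicit. Unset Printing Implicit Defensive.

(* Upper bound. Suppose that all lists have size at least k and that there is no
   colouring. We claim that k is even and that the four lists on the big part A
   have size exactly k; this gives h <= k for k odd and h <= k + 1 in any case.

   If some 2-part has a common colour c, use c on it and delete c elsewhere: by
   induction the lists on A have size k - 1 after the deletion, so c lies in all
   of them. Then use c on A instead, and colour the 2-parts, which form
   K(2,...,2), from lists of size k - 1.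

   Otherwise the two lists on each 2-part are disjoint, and Hall's marriage
   theorem, applied after giving a colour to some vertices of A, shows that no
   colour occurs in three lists on A, and that all lists lie in the 2k-element
   union U of the two lists on any 2-part, each colour of U occurring in exactly
   two lists on A. If c occurs on a pair B of A and d on the complementary pair
   A \ B, then using both on A leads to a colouring unless each 2-part has a
   list containing c and d. As equally many colours occur on B and on A \ B, the
   list L(u) of a vertex u of a 2-part contains equally many of both kinds; for a
   fixed a in A this splits L(u) into halves L(u) :&: L(a) and L(u) :\: L(a).

   Lower bound. Let 2h be the largest even number up to k, and let A0, A1, B0, B1
   be disjoint sets of h colours. On each of 2h - 1 of the 2-parts the lists
   are A0 + A1 and B0 + B1; on the big part they are the four sets Ai + Bj; the
   other vertices have private colours. The 2-parts leave only one colour in each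
   of A0 + A1 and B0 + B1, and some list Ai + Bj avoids both. *)

Lemma sum_tight (I : finType) (S : {set I}) (f g : I -> nat) :
  {in S, forall i, f i <= g i} -> \sum_(i in S) g i <= \sum_(i in S) f i ->
  {in S, forall i, f i = g i}.
Proof.
move=> fg sum_le; have H i : i \in S -> f i <= g i ?= iff (f i == g i).
  by move=> iS; split=> //; apply: fg.
have [le] := leqif_sum H; rewrite eqn_leq le sum_le => /esym/forall_inP h i iS.
by apply/eqP/h.
Qed.

(** * Unions of lists, double counting and Hall's marriage theorem *)

Section Unions.
Variables V C : finType.
Implicit Types (F L : V -> {set C}) (S T W : {set V}).

Definition palette L S : {set C} := \bigcup_(v in S) L v.

Lemma paletteS L S T : S \subset T -> palette L S \subset palette L T.
Proof.
move=> ST; apply/bigcupsP => v vS; apply: bigcup_sup.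
exact: (subsetP ST).
Qed.

Lemma sub_palette L S v : v \in S -> L v \subset palette L S.
Proof. by move=> vS; apply: bigcup_sup. Qed.

Lemma palette_setD L S Q : palette (fun v => L v :\: Q) S = palette L S :\: Q.
Proof.
apply/setP => c; rewrite in_setD; apply/bigcupP/andP.
  by case=> v vS /setDP[cv cQ]; split=> //; apply/bigcupP; exists v.
by case=> cQ /bigcupP[v vS cv]; exists v => //; apply/setDP.
Qed.

Lemma double_count L S (U : {set C}) : palette L S \subset U ->
  \sum_(v in S) #|L v| = \sum_(c in U) #|[set v in S | c \in L v]|.
Proof.
move=> SU; under eq_bigr => v vS do rewrite -sum1_card.
rewrite (exchange_big_dep (mem U)) /=; last first.
  by move=> v c vS cv; apply: (subsetP SU); apply/bigcupP; exists v.
apply: eq_bigr => c _; rewrite -sum1_card; apply: eq_bigl => v.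
by rewrite inE.
Qed.

Lemma double_count_leq L S m : (forall c, #|[set v in S | c \in L v]| <= m) ->
  \sum_(v in S) #|L v| <= m * #|palette L S|.
Proof.
move=> hm; rewrite (double_count (subxx _)) mulnC -sum_nat_const.
by apply: leq_sum.
Qed.

(** Induction on [#|W|]. If a nonempty proper subset [T] has exactly [#|T|] colours, [T] is matched
    first and [W :\: T] from the colours outside those of [T]. Otherwise every nonempty proper
    subset has a colour to spare, so a vertex [w] can take any of its colours. [c0] is a default
    value for empty [W]. *)
Theorem hall_marriage (c0 : C) F W :
  (forall S, S \subset W -> #|S| <= #|palette F S|) ->
  exists g : V -> C, {in W, forall v, g v \in F v} /\ {in W &, injective g}.
Proof.
have [n] := ubnP #|W|; elim: n => // n IH in F W *; rewrite ltnS => Wn hall.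
have [W0|/set0Pn[w wW]] := eqVneq W set0.
  by exists (fun=> c0); rewrite W0; split=> [v|u v]; rewrite inE.
have [/existsP[T /and4P[T0 TW TnW /eqP UT]]|tight] := boolP [exists T : {set V},
    [&& T != set0, T \subset W, T != W & #|palette F T| == #|T|]].
  have TpW : T \proper W by rewrite properEneq TnW.
  have [||g1 [g1F g1i]] := IH F T.
  - exact: leq_trans (proper_card TpW) Wn.
  - by move=> S ST; apply: hall; apply: subset_trans TW.
  have [||g2 [g2F g2i]] := IH (fun v => F v :\: palette F T) (W :\: T).
  - have := cardsD W T; rewrite (setIidPr TW).
    by move: T0; rewrite -card_gt0; have := subset_leq_card TW; lia.
  - move=> S /subsetDP[SW ST]; rewrite palette_setD.
    have /hall : S :|: T \subset W by rewrite subUset SW.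
    rewrite cardsU (disjoint_setI0 ST) cards0 subn0 /palette bigcup_setU.
    rewrite -/(palette F S) -/(palette F T).
    by have := cardsU (palette F S) (palette F T); have := cardsD (palette F S) (palette F T); lia.
  have g2W v : v \in W -> v \notin T -> (g2 v \in F v) && (g2 v \notin palette F T).
    by move=> vW vT; rewrite andbC -in_setD; apply: g2F; rewrite inE vT.
  have g1T v : v \in T -> g1 v \in palette F T.
    by move=> vT; apply: (subsetP (sub_palette F vT)); apply: g1F.
  exists (fun v => if v \in T then g1 v else g2 v); split=> [v vW|u v uW vW].
    by case: ifPn => vT; [exact: g1F | case/andP: (g2W v vW vT)].
  case: ifPn => uT; case: ifPn => vT; first exact: g1i.
  - by move=> E; case/andP: (g2W v vW vT) => _ /negP[]; rewrite -E g1T.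
  - by move=> E; case/andP: (g2W u uW uT) => _ /negP[]; rewrite E g1T.
  - by apply: g2i; rewrite inE ?uT ?vT.
have /card_gt0P[c cw] : 0 < #|F w|.
  have := hall [set w]; rewrite sub1set /palette big_set1 cards1; exact.
have [||g [gF gi]] := IH (fun v => F v :\ c) (W :\ w).
- by rewrite (cardsD1 w) wW in Wn; move: Wn; lia.
- move=> S; rewrite subsetD1 => /andP[SW wS]; rewrite palette_setD.
  have [->|S0] := eqVneq S set0; first by rewrite cards0.
  have: #|palette F S| != #|S|.
    apply/negP => E; move/existsP: tight; case; exists S; rewrite S0 SW E !andbT.
    by apply: contraNneq wS => ->.
  by have := hall S SW; have := cardsD1 c (palette F S); lia.
have gW v : v \in W -> v != w -> (g v != c) && (g v \in F v).
  by move=> vW vw; rewrite -in_setD1; apply: gF; rewrite !inE vw.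
exists (fun v => if v == w then c else g v); split=> [v vW|u v uW vW].
  by case: eqVneq => [->//|vw]; case/andP: (gW v vW vw).
case: eqVneq => [->|uw]; case: eqVneq => [->|vw] //.
- by move=> E; case/andP: (gW v vW vw); rewrite E eqxx.
- by move=> E; case/andP: (gW u uW uw); rewrite E eqxx.
- by apply: gi; rewrite !inE ?uw ?vw.
Qed.

End Unions.

(** * Colouring a set of vertices from lists *)

Section Coloring.
Variables (V C : finType) (e : rel V).
Hypothesis (e_irr : irreflexive e).
Implicit Types (L : V -> {set C}) (A B S W X : {set V}) (P : {set {set V}}).

Definition colorable L W : bool :=
  [exists psi : {ffun V -> C}, [forall v in W, psi v \in L v] &&
     [forall u in W, forall v in W, e u v ==> (psi u != psi v)]].

Lemma colorableP L W :
  reflect (exists psi : V -> C, {in W, forall v, psi v \in L v} /\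
             {in W &, forall u v, e u v -> psi u != psi v})
          (colorable L W).
Proof.
apply: (iffP existsP) => [[psi /andP[/forall_inP h1 /forall_inP h2]]|[psi [h1 h2]]].
  exists psi; split=> // u v uW vW.
  by have /forall_inP/(_ v vW)/implyP := h2 u uW.
exists (finfun psi); apply/andP; split; first by apply/forall_inP => v vW; rewrite ffunE h1.
apply/forall_inP => u uW; apply/forall_inP => v vW; apply/implyP => uv.
by rewrite !ffunE h2.
Qed.

(** No clash arises inside [B], which is independent, nor across, since the colours of [B] are
    deleted from all other lists. *)
Lemma colorable_extend L W B (h : V -> C) : B \subset W ->
    independent e B -> {in B, forall v, h v \in L v} ->
    colorable (fun v => L v :\: h @: B) (W :\: B) -> colorable L W.
Proof.
move=> BW /forall_inP indB hL /colorableP[psi [psiL psie]].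
have psiW v : v \in W -> v \notin B -> (psi v \notin h @: B) && (psi v \in L v).
  by move=> vW vB; rewrite -in_setD psiL // inE vB.
apply/colorableP; exists (fun v => if v \in B then h v else psi v); split=> [v vW|u v uW vW uv].
  by case: ifPn => vB; [exact: hL | case/andP: (psiW v vW vB)].
case: ifPn => uB; case: ifPn => vB.
- by have /forall_inP/(_ v vB) := indB u uB; rewrite uv.
- by case/andP: (psiW v vW vB) => + _; apply: contraNneq => <-; apply: imset_f.
- by case/andP: (psiW u uW uB) => + _; apply: contraNneq => ->; apply: imset_f.
- by apply: psie => //; rewrite inE ?uB ?vB.
Qed.

Lemma colorable_const L W B c : B \subset W -> independent e B ->
  {in B, forall v, c \in L v} -> colorable (fun v => L v :\ c) (W :\: B) -> colorable L W.
Proof.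
move=> BW indB cB /colorableP[psi [psiL psie]].
apply: (colorable_extend BW indB cB); apply/colorableP; exists psi; split=> // v vW.
apply: subsetP (psiL v vW); apply: setDS.
by apply/subsetP => _ /imsetP[w _ ->]; rewrite inE.
Qed.

Lemma colorable_hall (c0 : C) L W :
  (forall S, S \subset W -> #|S| <= #|palette L S|) -> colorable L W.
Proof.
move=> hall; have [g [gL gi]] := hall_marriage c0 hall.
apply/colorableP; exists g; split=> // u v uW vW; apply: contraTneq => /(gi u v uW vW) ->.
by rewrite e_irr.
Qed.

Lemma not_colorable_hall (c0 : C) L W B (h : V -> C) : B \subset W ->
    independent e B -> {in B, forall v, h v \in L v} -> ~~ colorable L W ->
  exists2 S : {set V}, S \subset W :\: B & #|palette L S :\: h @: B| < #|S|.
Proof.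
move=> BW indB hL; have [/forallP hall|] := boolP [forall S : {set V},
    (S \subset W :\: B) ==> (#|S| <= #|palette L S :\: h @: B|)].
  case/negP; apply: (colorable_extend BW indB hL); apply: (colorable_hall c0) => S SW.
  by rewrite palette_setD; apply: implyP (hall S) SW.
by move/forallPn => [S]; rewrite negb_imply -ltnNge => /andP[? ?] _; exists S.
Qed.

(** A union bound that keeps the exact contribution of one block [X]: when [S] is as large as the
    bounds allow, it must fill or meet every block. *)
Lemma card_leq_blocks A P S X b : X \in P -> S \subset A :|: cover P ->
    {in P, forall Y, #|S :&: Y| <= b} ->
  #|S| <= #|S :&: A| + #|S :&: X| + b * #|P|.-1.
Proof.
move=> XP SD hb; have -> : S = (S :&: A) :|: (S :&: cover P).
  by rewrite -setIUr (setIidPl SD).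
have -> : S :&: cover P = \bigcup_(Y in P) (S :&: Y).
  by rewrite /cover big_distrr.
have bnd : #|\bigcup_(Y in P) (S :&: Y)| <= \sum_(Y in P) #|S :&: Y|.
  elim/big_rec2: _ => [|Y n T _ le]; first by rewrite cards0.
  by rewrite (leq_trans (leq_card_setU _ _)) // leq_add2l.
apply: leq_trans (leq_card_setU _ _) _.
(* Rewriting [S] also changed the right-hand side; this restores it. *)
have SSA T : ((S :&: A) :|: \bigcup_(Y in P) (S :&: Y)) :&: T = S :&: T.
  by rewrite -(big_distrr) /= -/(cover P) -setIUr (setIidPl SD).
rewrite !SSA -addnA leq_add2l; apply: leq_trans bnd _.
rewrite (bigD1 X) //= leq_add2l.
apply: leq_trans (_ : \sum_(Y in P | Y != X) b <= _).
  by apply: leq_sum => Y /andP[YP _]; apply: hb.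
rewrite sum_nat_const mulnC leq_mul2l; apply/orP; right.
have -> : #|[pred Y in P | Y != X]| = #|P :\ X|.
  by apply: eq_card => Y; rewrite !inE andbC.
by rewrite (cardsD1 X P) XP.
Qed.

Lemma card_leq_blocks0 A P S b : S \subset A :|: cover P ->
    {in P, forall Y, #|S :&: Y| <= b} ->
  #|S| <= #|S :&: A| + b * #|P|.
Proof.
move=> SD hb; have [P0|/set0Pn[X XP]] := eqVneq P set0.
  by move: SD; rewrite P0 /cover big_set0 setU0 => /setIidPl->; rewrite leq_addr.
apply: leq_trans (card_leq_blocks XP SD hb) _.
by rewrite (cardsD1 X P) XP; have := hb X XP; lia.
Qed.

Lemma palette_block_ge L X k : #|X| = 2 -> {in X, forall v, k <= #|L v|} ->
    (forall c, exists2 v, v \in X & c \notin L v) -> 2 * k <= #|palette L X|.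
Proof.
move=> X2 Lk dis; rewrite -[#|_|]mul1n.
apply: leq_trans (double_count_leq (L := L) (S := X) (m := 1) _).
  by rewrite -X2 -sum_nat_const; apply: leq_sum.
move=> c; have [v vX cv] := dis c.
rewrite -ltnS -X2; apply: proper_card; apply/properP; split.
  by apply/subsetP => w; rewrite inE => /andP[].
by exists v => //; rewrite inE vX.
Qed.

Lemma block_list_inj L X u v c : #|X| = 2 ->
  (forall c, exists2 v, v \in X & c \notin L v) ->
  u \in X -> v \in X -> c \in L u -> c \in L v -> u = v.
Proof.
move=> X2 dis uX vX cu cv; apply/eqP/negPn/negP => uv.
have [w wX] := dis c; case/negP.
have /eqP E : [set u; v] == X.
  by rewrite eqEcard subUset !sub1set uX vX X2 cards2 uv.
by move: wX; rewrite -E => /set2P[]->.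
Qed.

End Coloring.

(** * Blocks of two vertices *)

Section Blocks.
Variables (V C : finType) (e : rel V).
Hypothesis e_irr : irreflexive e.
Implicit Types (L : V -> {set C}) (A B S W X : {set V}) (P : {set {set V}}).

Lemma colorableS L S W : S \subset W -> colorable e L W -> colorable e L S.
Proof.
move=> /subsetP SW /colorableP[psi [psiL psie]]; apply/colorableP; exists psi.
by split=> [v /SW /psiL|u v /SW uW /SW vW] //; apply: psie.
Qed.

Lemma card_block_partial S X : #|X| = 2 -> ~~ (X \subset S) -> #|S :&: X| <= 1.
Proof.
move=> X2 XS; rewrite -ltnS -X2; apply: proper_card.
by rewrite properE subsetIr subsetI subxx andbT.
Qed.

Definition disjoint_lists L X := forall c, exists2 v, v \in X & c \notin L v.

Lemma disjoint_listsP P L :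
  (exists X c, X \in P /\ {in X, forall v, c \in L v}) \/ {in P, forall X, disjoint_lists L X}.
Proof.
have [/existsP[X /existsP[c /andP[XP /forall_inP h]]]|none] :=
  boolP [exists X : {set V}, exists c, (X \in P) && [forall v in X, c \in L v]].
  by left; exists X, c.
right=> X XP c; move/existsPn/(_ X)/existsPn/(_ c): none; rewrite XP /=.
by case/forall_inPn => v; exists v.
Qed.

Lemma setUDcover A P X : (A :|: cover P) :\: X \subset A :|: cover (P :\ X).
Proof.
apply/subsetP => v; rewrite !inE => /andP[vX /orP[->//|/bigcupP[Y YP vY]]].
apply/orP; right; apply/bigcupP; exists Y => //; rewrite !inE YP andbT.
by apply: contraNneq vX => <-.
Qed.

(** Choosability of K(2,...,2). A colour common to a block is used there and costs the other lists
    at most one colour. If there is none, Hall's theorem applies: a set containing a block [X] has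
    at most [2 * #|P|] vertices, and the disjoint lists on [X] supply as many colours; any other set
    has at most [#|P|] vertices, so one list suffices. *)
Lemma colorable_blocks (c0 : C) L P :
    {in P, forall X, #|X| = 2 /\ independent e X} ->
    {in cover P, forall v, #|P| <= #|L v|} -> colorable e L (cover P).
Proof.
have [n] := ubnP #|P|; elim: n => // n IH in L P *; rewrite ltnS => Pn blk Lk.
have [[X [c [XP cX]]]|dis] := disjoint_listsP P L.
  have [X2 indX] := blk X XP; have cardP := cardsD1 X P; rewrite XP in cardP.
  apply: (colorable_const (bigcup_sup _ XP) indX cX).
  have := setUDcover set0 P X; rewrite !set0U => sub; apply: colorableS sub _.
  apply: IH => [|Y /setD1P[_ /blk]//|v /bigcupP[Y /setD1P[_ YP] vY]].
    by apply: leq_trans Pn; rewrite cardP.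
  have vP : v \in cover P by apply/bigcupP; exists Y.
  have := Lk v vP; rewrite cardP => /leq_trans vL.
  by rewrite -ltnS; apply: vL; have := cardsD1 c (L v); lia.
apply: (colorable_hall e_irr c0) => S SP.
have SP' : S \subset set0 :|: cover P by rewrite set0U.
have [/existsP[X /andP[XP XS]]|noX] := boolP [exists X in P, X \subset S].
  have le : #|S| <= #|S :&: set0| + 2 * #|P|.
    apply: card_leq_blocks0 => // Y /blk[<- _]; exact: subset_leq_card (subsetIr _ _).
  rewrite setI0 cards0 in le; apply: leq_trans le _.
  apply: leq_trans (subset_leq_card (paletteS L XS)).
  apply: palette_block_ge; [by case: (blk X XP) | | exact: dis].
  by move=> v vX; apply: Lk; apply/bigcupP; exists X.
have le : #|S| <= #|S :&: set0| + 1 * #|P|.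
  apply: card_leq_blocks0 => // Y YP; apply: card_block_partial; first by case: (blk Y YP).
  by move/existsPn/(_ Y): noX; rewrite YP.
have [->|/set0Pn[v vS]] := eqVneq S set0; first by rewrite cards0.
rewrite setI0 cards0 mul1n in le; apply: leq_trans le _.
apply: leq_trans (subset_leq_card (sub_palette L vS)).
by apply: Lk; apply: (subsetP SP).
Qed.

(** * Consequences of non-colourability when each block has disjoint lists *)

Section DisjointBlocks.
Variables (A : {set V}) (P : {set {set V}}) (L : V -> {set C}) (k : nat).
Hypotheses (A4 : #|A| = 4) (indA : independent e A).
Hypothesis blk : {in P, forall X, #|X| = 2 /\ independent e X}.
Hypothesis kP : k = #|P|.+1.
Hypothesis Lk : {in A :|: cover P, forall v, k <= #|L v|}.
Hypothesis dis : {in P, forall X, disjoint_lists L X}.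
Hypothesis ncol : ~~ colorable e L (A :|: cover P).

Let inD X v : X \in P -> v \in X -> v \in A :|: cover P.
Proof. by move=> XP vX; apply/setUP; right; apply/bigcupP; exists X. Qed.

Let AinD v : v \in A -> v \in A :|: cover P.
Proof. by move=> vA; rewrite inE vA. Qed.

Let A_color c := [set a in A | c \in L a].

Let A_colorS c : A_color c \subset A.
Proof. by apply/subsetP => a; rewrite inE => /andP[]. Qed.

Lemma independentS B : B \subset A -> independent e B.
Proof.
move=> /subsetP BA; apply/forall_inP => u /BA uA; apply/forall_inP => v /BA vA.
by have /forall_inP/(_ u uA)/forall_inP/(_ v vA) := indA.
Qed.

Lemma list_nonempty (a : V) : a \in A -> exists c0 : C, c0 \in L a.
Proof. by move=> /AinD/Lk; rewrite kP => /(leq_trans (ltn0Sn _))/card_gt0P. Qed.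

(* Colours B through h and applies Hall's theorem to the other vertices: the
   violating set S either contains a block, or meets each block at most once. *)
Lemma violator B (h : V -> C) : B \subset A -> {in B, forall v, h v \in L v} ->
  exists S : {set V}, [/\ S \subset (A :|: cover P) :\: B,
    #|palette L S :\: h @: B| < #|S| &
    (exists2 X, X \in P & [/\ X \subset S,
        forall Y, Y \in P -> #|S| <= #|S :&: A| + #|S :&: Y| + 2 * (k - 2),
        #|S| <= #|S :&: A| + 2 * (k - 1) & 2 * k <= #|palette L X|])
    \/ ((forall Y, Y \in P -> #|S| <= #|S :&: A| + #|S :&: Y| + (k - 2)) /\
        #|S| <= #|S :&: A| + (k - 1))].
Proof.
move=> BA hL; have [c0 _] : exists c0 : C, true.
  have /card_gt0P[a aA] : 0 < #|A| by rewrite A4.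
  by have [c _] := list_nonempty aA; exists c.
have BD : B \subset A :|: cover P by rewrite (subset_trans BA) ?subsetUl.
have [S SD lt] := not_colorable_hall e_irr c0 BD (independentS BA) hL ncol.
exists S; split=> //; have SD' := subset_trans SD (subsetDl _ _).
have -> : k - 1 = #|P| by rewrite kP subn1.
have -> : k - 2 = #|P|.-1 by rewrite kP -subn1 subSS.
have [/existsP[X /andP[XP XS]]|noX] := boolP [exists X in P, X \subset S]; [left|right].
  have b2 : {in P, forall Y, #|S :&: Y| <= 2}.
    by move=> Y /blk[<- _]; exact: subset_leq_card (subsetIr _ _).
  exists X => //; split=> //.
  - by move=> Y YP; apply: card_leq_blocks.
  - exact: card_leq_blocks0.
  - apply: palette_block_ge; [by case: (blk XP) | | exact: dis].
    by move=> v /(inD XP)/Lk.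
have b1 : {in P, forall Y, #|S :&: Y| <= 1}.
  move=> Y YP; apply: card_block_partial; first by case: (blk YP).
  by move/existsPn/(_ Y): noX; rewrite YP.
split=> [Y YP|]; first by have := card_leq_blocks YP SD' b1; rewrite mul1n.
by have := card_leq_blocks0 SD' b1; rewrite mul1n.
Qed.

Lemma violator_A S B : S \subset (A :|: cover P) :\: B -> S :&: A \subset A :\: B.
Proof.
move/subsetP => SD; apply/subsetP => v /setIP[/SD] + vA.
by rewrite !inE vA andbT.
Qed.

Lemma palette_card S X c : X \subset S -> #|palette L X| <= #|palette L S :\ c|.+1.
Proof.
move=> /(paletteS L)/subset_leq_card.
by have := cardsD1 c (palette L S); lia.
Qed.

(** If [c] were in three lists, giving it to those vertices would leave at most one vertex of [A] in
    the violator [S]. A block in [S] has [2 * k - 1] colours besides [c], enough for [S]. Without a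
    block, one list suffices: that of a vertex of [A] in [S], which avoids [c], or any list if [S]
    misses [A]. *)
Lemma A_color_le2 c : #|A_color c| <= 2.
Proof.
rewrite leqNgt; apply/negP => gt2.
have cB : {in A_color c, forall v, c \in L v} by move=> v; rewrite inE => /andP[].
have [S [SD lt shape]] := violator (A_colorS c) cB.
have im : (fun=> c) @: A_color c = [set c].
  apply/eqP; rewrite eqEsubset; apply/andP; split.
    by apply/subsetP => _ /imsetP[w _ ->]; rewrite inE.
  have /card_gt0P[a aB] : 0 < #|A_color c| by lia.
  by rewrite sub1set; apply/imsetP; exists a.
rewrite im in lt.
have SA1 : #|S :&: A| <= 1.
  apply: leq_trans (subset_leq_card (violator_A SD)) _.
  by rewrite cardsD (setIidPr (A_colorS c)) A4; lia.
case: shape => [[X XP [XS _ le ge]]|[_ le]].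
  by have := palette_card c XS; lia.
have [SA0|/set0Pn[a /setIP[aS aA]]] := eqVneq (S :&: A) set0.
  have /card_gt0P[v vS] : 0 < #|S| by lia.
  have := Lk (subsetP (subset_trans SD (subsetDl _ _)) v vS).
  have := subset_leq_card (setSD [set c] (sub_palette L vS)).
  by have := cardsD1 c (L v); rewrite SA0 cards0 in le; lia.
have caL : c \notin L a.
  by have := subsetP SD a aS; rewrite !inE aA /= andbT.
have := Lk (AinD aA).
have := subset_leq_card (setSD [set c] (sub_palette L aS)).
by have := cardsD1 c (L a); rewrite (negbTE caL); lia.
Qed.

(** Otherwise the lists on [A] are pairwise disjoint, so [S :&: A] alone has [#|S :&: A| * k]
    colours, too many for a violator [S] that meets [A] in at least two vertices; one block or one
    list handles the rest. *)
Lemma shared_color : exists c, #|A_color c| = 2.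
Proof.
have [/existsP[c /eqP c2]|none] := boolP [exists c, #|A_color c| == 2]; first by exists c.
have le1 c : #|A_color c| <= 1.
  by move/existsPn/(_ c): none; have := A_color_le2 c; lia.
have [S [SD]] : exists S : {set V}, [/\ S \subset (A :|: cover P), 
   #|palette L S| < #|S| & 
    (exists2 X, X \in P & [/\ X \subset S,
        #|S| <= #|S :&: A| + 2 * (k - 1) & 2 * k <= #|palette L X|])
    \/ #|S| <= #|S :&: A| + (k - 1)].
  have /card_gt0P[a aA] : 0 < #|A| by rewrite A4.
  have [c _] := list_nonempty aA.
  have [v|S [SD lt shape]] := @violator set0 (fun=> c) (sub0set _); first by rewrite inE.
  exists S; rewrite imset0 !setD0 in SD lt; split=> //.
  by case: shape => [[X XP [XS _ le ge]]|[_ le]]; [left; exists X | right].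
have SAU : #|S :&: A| * k <= #|palette L S|.
  have := @double_count_leq _ _ L (S :&: A) 1.
  rewrite mul1n => H; apply: leq_trans (subset_leq_card (paletteS L (subsetIl S A))).
  apply: leq_trans (H _).
    rewrite -sum_nat_const; apply: leq_sum => v /setIP[_ /AinD]; exact: Lk.
  move=> c; apply: leq_trans (le1 c); apply: subset_leq_card.
  by apply/subsetP => v; rewrite !inE -andbA => /and3P[_ -> ->].
have kpos : 0 < k by rewrite kP.
move=> lt [[X XP [XS le ge]]|le].
  have := subset_leq_card (paletteS L XS).
  by case: (#|S :&: A|) SAU le => [|[|n]] //; nia.
case E: (#|S :&: A|) SAU le => [|[|n]] SAU le; try nia.
have /card_gt0P[v vS] : 0 < #|S| by lia.
by have := subset_leq_card (sub_palette L vS); have := Lk (subsetP SD v vS); lia.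
Qed.

(** With [c] and [d] used on all of [A], the violator misses [A], and it contains no block, whose
    [2 * k - 2] remaining colours would suffice. It therefore has at most [k - 1] vertices, but more
    than the at least [k - 2] colours left in any of its lists: all these bounds are equalities, and
    it meets every block. *)
Lemma two_shared_colors c d : #|A_color c| = 2 -> A_color d = A :\: A_color c ->
  P != set0 /\ {in P, forall X, exists2 v, v \in X & [/\ c \in L v, d \in L v & #|L v| = k]}.
Proof.
move=> c2 Ad; pose h v := if v \in A_color c then c else d.
have hL : {in A, forall v, h v \in L v}.
  move=> v vA; rewrite /h; case: ifPn => [|vc]; first by rewrite inE => /andP[].
  have : v \in A_color d by rewrite Ad inE vc.
  by rewrite inE => /andP[].
have [S [SD lt shape]] := violator (subxx A) hL.
have hA : h @: A \subset [set c; d].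
  by apply/subsetP => _ /imsetP[v _ ->]; rewrite /h !inE; case: ifP; rewrite eqxx ?orbT.
have {hA}lt : #|palette L S :\: [set c; d]| < #|S|.
  exact: leq_ltn_trans (subset_leq_card (setDS _ hA)) lt.
have SA0 : S :&: A = set0.
  by apply/eqP; rewrite -subset0; have := violator_A SD; rewrite setDv.
have cd2 (T : {set C}) : #|T| = #|T :&: [set c; d]| + #|T :\: [set c; d]| /\
    #|T :&: [set c; d]| <= #|[set c; d]| <= 2.
  by rewrite cardsID subset_leq_card ?subsetIr //= cards2; case: (_ != _).
rewrite SA0 cards0 in shape; case: shape => [[X XP [XS _ le ge]]|[leX le]].
  have := subset_leq_card (paletteS L XS).
  by have := cd2 (palette L S); lia.
have /card_gt0P[w wS] : 0 < #|S| by lia.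
have sub v : v \in S -> #|L v :\: [set c; d]| <= #|palette L S :\: [set c; d]|.
  by move=> vS; apply: subset_leq_card; apply: setSD; apply: sub_palette.
have Sk v : v \in S -> k <= #|L v|.
  move=> vS; exact: Lk (subsetP (subset_trans SD (subsetDl _ _)) v vS).
have := sub w wS; have := Sk w wS; have := cd2 (L w) => cd2w kw subw.
split; first by rewrite -card_gt0; move: le lt; rewrite kP subn1 /=; lia.
move=> X XP; have /card_gt0P[v /setIP[vS vX]] : 0 < #|S :&: X| by have := leX X XP; lia.
exists v => //; have := cd2 (L v); have := sub v vS; have := Sk v vS => kv subv cd2v.
have /eqP E : L v :&: [set c; d] == [set c; d].
  by rewrite eqEcard subsetIr; lia.
have Lcd x : x \in [set c; d] -> x \in L v by rewrite -E => /setIP[].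
by split; [apply: Lcd; rewrite set21 | apply: Lcd; rewrite set22 | lia].
Qed.

(** Use [c] on its two vertices. If the violator [S] contains a block, the count is tight: [S]
    consists of all blocks and the rest of [A], and has exactly [2 * k - 1] colours besides [c]. *)
Lemma shared_color_palette c : #|A_color c| = 2 ->
  P != set0 /\ {in P, forall X, [/\ #|palette L X| = 2 * k, c \in palette L X &
    {in A :\: A_color c, forall a, L a \subset palette L X}]}.
Proof.
move=> c2.
have cB : {in A_color c, forall v, c \in L v} by move=> v; rewrite inE => /andP[].
have [S [SD lt shape]] := violator (A_colorS c) cB.
have im : (fun=> c) @: A_color c = [set c].
  apply/eqP; rewrite eqEsubset; apply/andP; split.
    by apply/subsetP => _ /imsetP[w _ ->]; rewrite inE.
  have /card_gt0P[a aB] : 0 < #|A_color c| by lia.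
  by rewrite sub1set; apply/imsetP; exists a.
rewrite im in lt; have SA := violator_A SD.
have AB2 : #|A :\: A_color c| = 2 by rewrite cardsD (setIidPr (A_colorS c)) A4 c2.
have SA2 : #|S :&: A| <= 2 by rewrite -AB2 subset_leq_card.
have SAE : 2 <= #|S :&: A| -> S :&: A = A :\: A_color c.
  by move=> ge2; apply/eqP; rewrite eqEcard SA AB2.
have cA a : a \in A :\: A_color c -> c \notin L a.
  by rewrite !inE; case: (a \in A); rewrite ?andbF ?andbT.
case: shape => [[X XP [XS leX le ge]]|[_ le]].
  split=> [|Y YP]; first by apply/set0Pn; exists X.
  have lb := palette_card c XS.
  have k2 : 1 < k by rewrite kP ltnS card_gt0; apply/set0Pn; exists X.
  have small : #|palette L S :\ c| < 2 * k by clear -lt le SA2 k2; lia.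
  have S2k : 2 * k <= #|S| by clear -lt ge lb; lia.
  have {}SAE : S :&: A = A :\: A_color c by apply: SAE; clear -S2k le k2; lia.
  have YS : Y \subset S.
    have [Y2 _] := blk YP; apply/setIidPr/eqP; rewrite eqEcard subsetIr Y2.
    by have := leX Y YP; clear -S2k SA2 k2; lia.
  have Yge : 2 * k <= #|palette L Y|.
    apply: palette_block_ge; [by case: (blk YP) | | exact: dis].
    by move=> v /(inD YP)/Lk.
  have cY := cardsD1 c (palette L Y).
  have YSc : #|palette L Y :\ c| <= #|palette L S :\ c|.
    by apply: subset_leq_card; apply: setSD; apply: paletteS.
  have cin : c \in palette L Y.
    by case: (c \in _) cY => //; clear -Yge YSc small; lia.
  rewrite cin in cY; split=> //; first by clear -Yge YSc small cY; lia.
  move=> a aAB; have aS : a \in S.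
    by have := aAB; rewrite -SAE => /setIP[].
  have /eqP E : palette L Y :\ c == palette L S :\ c.
    by rewrite eqEcard (setSD _ (paletteS L YS)) /=; clear -Yge small cY; lia.
  apply/subsetP => x xa; have xc : x != c by apply: contraTneq xa => ->; exact: cA.
  have : x \in palette L S :\ c by rewrite !inE xc (subsetP (sub_palette L aS)).
  by rewrite -E => /setD1P[].
(* If [S] contains no block, the other two vertices of [A] have the same list of [k] colours, each
   complementary to [c]. The vertex [u] of a block whose list contains [c] must then list them all,
   against [#|L u| = k]. *)
have [SA0|/set0Pn[a /setIP[aS aA]]] := eqVneq (S :&: A) set0.
  have /card_gt0P[v vS] : 0 < #|S| by lia.
  have := Lk (subsetP (subset_trans SD (subsetDl _ _)) v vS).
  have := subset_leq_card (setSD [set c] (sub_palette L vS)).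
  by have := cardsD1 c (L v); rewrite SA0 cards0 in le; lia.
have YL x : x \in S -> x \in A -> [/\ k <= #|L x|, c \notin L x & L x \subset palette L S :\ c].
  move=> xS xA; have xc : c \notin L x by apply: cA; apply: (subsetP SA); rewrite inE xS.
  by rewrite subsetD1 xc Lk ?AinD ?sub_palette.
have [ka ca aY] := YL a aS aA; have leY := subset_leq_card aY.
have kpos : 0 < k by rewrite kP.
have {}SAE : S :&: A = A :\: A_color c by apply: SAE; clear -kpos le lt ka leY; lia.
have cardY : #|palette L S :\ c| = k by clear -kpos le lt ka leY SA2; lia.
have LY x : x \in A :\: A_color c -> L x = palette L S :\ c.
  rewrite -SAE => /setIP[xS xA]; have [kx cx xY] := YL x xS xA.
  by apply/eqP; rewrite eqEcard xY cardY.
have Ad d : d \in palette L S :\ c -> A_color d = A :\: A_color c.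
  move=> dY; apply/esym/eqP; rewrite eqEcard AB2 A_color_le2 andbT.
  by apply/subsetP => x xAB; rewrite inE (LY x) // dY andbT; case/setDP: xAB.
have /card_gt0P[d dY] : 0 < #|palette L S :\ c| by rewrite cardY kP.
have [/set0Pn[X XP] /(_ X XP)[u uX [cu du ku]]] := two_shared_colors c2 (Ad d dY).
suff : #|c |: (palette L S :\ c)| <= #|L u|.
  by rewrite cardsU1 cardY ku !inE eqxx /= add1n ltnn.
apply: subset_leq_card; rewrite subUset sub1set cu; apply/subsetP => d' dY'.
have [_ /(_ X XP)[w wX [cw dw kw]]] := two_shared_colors c2 (Ad d' dY').
have [X2 _] := blk XP.
by rewrite (block_list_inj X2 (dis XP) uX wX cu cw).
Qed.

(** The lists of the other two vertices each take at least [k] of the [2 * k - 1] palette colours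
    besides [c], so they meet. *)
Lemma complementary_color c : #|A_color c| = 2 -> exists d, A_color d = A :\: A_color c.
Proof.
move=> c2; have [/set0Pn[X XP] /(_ X XP)[U2k cU LU]] := shared_color_palette c2.
have AB2 : #|A :\: A_color c| = 2 by rewrite cardsD (setIidPr (A_colorS c)) A4 c2.
have /eqP/cards2P[x [y [xy AB]]] := AB2.
have LUc a : a \in A :\: A_color c -> L a \subset palette L X :\ c /\ k <= #|L a|.
  move=> aAB; have /setDP[aA ac] := aAB; split; last by rewrite Lk ?AinD.
  by rewrite subsetD1 LU //=; move: ac; rewrite inE aA.
have [|xU kx] := LUc x; first by rewrite AB set21.
have [|yU ky] := LUc y; first by rewrite AB set22.
have /card_gt0P[d /setIP[dx dy]] : 0 < #|L x :&: L y|.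
  have := cardsU (L x) (L y); have := cardsD1 c (palette L X); rewrite cU.
  have : #|L x :|: L y| <= #|palette L X :\ c| by rewrite subset_leq_card // subUset xU.
  have : 0 < k by rewrite kP.
  by clear -kx ky U2k; lia.
exists d; apply/esym/eqP; rewrite eqEcard AB2 A_color_le2 andbT AB.
have xyA : [set x; y] \subset A by rewrite -AB subsetDl.
by move: xyA; rewrite !subUset !sub1set => /andP[xA yA]; rewrite !inE xA dx yA dy.
Qed.

Lemma list_sub_palette : exists2 X, X \in P &
  #|palette L X| = 2 * k /\ {in A, forall a, L a \subset palette L X}.
Proof.
have [c c2] := shared_color; have [/set0Pn[X XP] /(_ X XP)[U2k cU LU]] := shared_color_palette c2.
exists X => //; split=> // a aA; have [ac|ac] := boolP (a \in A_color c); last first.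
  by apply: LU; rewrite inE ac.
have [d Ad] := complementary_color c2.
have d2 : #|A_color d| = 2 by rewrite Ad cardsD (setIidPr (A_colorS c)) A4 c2.
have [_ /(_ X XP)[_ _]] := shared_color_palette d2; apply.
by rewrite Ad !inE aA /= andbT; move: ac; rewrite inE aA /= => ->.
Qed.

(** Incidences between [A] and colours number at least [4 * k] by vertices and at most [2 * (2 * k)]
    by colours, so both estimates are exact. *)
Lemma tight_lists : exists2 X, X \in P & [/\ #|palette L X| = 2 * k,
  {in A, forall a, #|L a| = k /\ L a \subset palette L X} &
  {in palette L X, forall c, #|A_color c| = 2}].
Proof.
have [X XP [U2k LU]] := list_sub_palette; exists X => //.
have AU : palette L A \subset palette L X by apply/bigcupsP.
have dc := double_count AU; rewrite -/A_color in dc.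
have geA : 4 * k <= \sum_(a in A) #|L a|.
  by rewrite -A4 -sum_nat_const; apply: leq_sum => a /AinD/Lk.
have leU : \sum_(c in palette L X) #|A_color c| <= 4 * k.
  apply: leq_trans (_ : \sum_(c in palette L X) 2 <= _).
    by apply: leq_sum => c _; apply: A_color_le2.
  by rewrite sum_nat_const U2k; lia.
split=> // [a aA|c cU].
  split; last exact: LU.
  apply/esym; apply: (sum_tight (f := fun=> k) (g := fun v => #|L v|) (S := A)) => //.
    by move=> v /AinD/Lk.
  by rewrite sum_nat_const A4 dc.
apply: (sum_tight (f := fun x => #|A_color x|) (g := fun=> 2) (S := palette L X)) => //.
  by move=> x _; apply: A_color_le2.
by rewrite -dc sum_nat_const U2k; apply: leq_trans geA; lia.
Qed.

Lemma disjoint_blocks_tight : ~~ odd k /\ {in A, forall a, #|L a| = k}.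
Proof.
have [X XP [U2k tight two]] := tight_lists.
split; last by move=> a /tight[].
have [X2 _] := blk XP.
have [c c2] := shared_color; have [d Ad] := complementary_color c2.
have [_ /(_ X XP)[u uX [cu _ <-]]] := two_shared_colors c2 Ad.
have uU := sub_palette L uX.
pose N (B : {set V}) := #|[set x in palette L X | A_color x == B]|.
pose n (B : {set V}) := #|[set x in L u | A_color x == B]|.
(* The lists on [B] have [2 * k] incidences in total, one per palette colour on average. A colour
   meets [B] once, except twice if its pair is [B] and never if it is [A :\: B]. *)
have NC (B : {set V}) : B \subset A -> #|B| = 2 -> N B = N (A :\: B).
  move=> BA B2.
  have BU : palette L B \subset palette L X.
    by apply/bigcupsP => a /(subsetP BA)/tight[].
  have := double_count BU.
  have -> : \sum_(a in B) #|L a| = 2 * k.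
    by rewrite -B2 -sum_nat_const; apply: eq_bigr => a /(subsetP BA)/tight[].
  have pw : \sum_(x in palette L X) (#|[set v in B | x \in L v]| + (A_color x == A :\: B))
       = \sum_(x in palette L X) (1 + (A_color x == B)).
    apply: eq_bigr => x /two x2.
    have -> : [set v in B | x \in L v] = A_color x :&: B.
      apply/setP => v; rewrite !inE andbC; case vB: (v \in B); rewrite ?andbF ?andbT //.
      by rewrite (subsetP BA).
    have eq2 (T : {set V}) : #|T| = 2 -> (A_color x == T) = (#|A_color x :&: T| == 2).
      move=> T2; rewrite eqEcard T2 x2 andbT; apply/setIidPl/eqP => [->//|E].
      by apply/eqP; rewrite eqEcard subsetIl E x2.
    have AB2 : #|A :\: B| = 2 by rewrite cardsD (setIidPr BA) A4 B2.
    rewrite !eq2 //.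
    have -> : A_color x :&: (A :\: B) = A_color x :\: B.
      by rewrite setIDA (setIidPl (A_colorS x)).
    have := cardsID B (A_color x); rewrite x2.
    case: #|_ :&: B| => [|[|[|m]]]; case: #|_ :\: B| => [|[|[|m']]] //; lia.
  have sumN (T : {set V}) : \sum_(x in palette L X) (A_color x == T : nat) = N T.
    rewrite /N -sum1_card big_mkcond [in RHS]big_mkcond; apply: eq_bigr => x _.
    by rewrite inE; case: (x \in _); case: (_ == _).
  by move: pw; rewrite !big_split /= sum1_card !sumN U2k => npq dcB; move: npq; rewrite -dcB => /addnI.
(* Once [L u] has a colour with pair [B], it has all colours with the complementary pair: a vertex
   of [X] lists both, and by disjointness it is [u]. *)
have nle (B : {set V}) : B \subset A -> n B <= n (A :\: B).
  move=> BA; have [->//|] := posnP (n B); case/card_gt0P => x.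
  rewrite inE => /andP[xu /eqP xB].
  have x2 := two x (subsetP uU x xu).
  have nN : n B <= N B.
    by apply: subset_leq_card; apply/subsetP => y; rewrite !inE => /andP[/(subsetP uU)->].
  apply: leq_trans nN _; rewrite NC // -?xB //; apply: subset_leq_card.
  apply/subsetP => y; rewrite !inE => /andP[yU /eqP yB]; rewrite yB eqxx andbT.
  have [_ /(_ X XP)[w wX [xw yw _]]] := two_shared_colors x2 yB.
  by rewrite (block_list_inj X2 (dis XP) uX wX xu xw).
have nC (B : {set V}) : B \subset A -> n (A :\: B) = n B.
  move=> BA; apply/eqP; rewrite eqn_leq nle // andbT.
  by have := nle _ (subsetDl A B); rewrite setDDr setDv set0U (setIidPr BA).
have /card_gt0P[a aA] : 0 < #|A| by rewrite A4.
(* Sort the colours of [L u] by whether [a] lists them; complementation shows that the two halves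
   are equal. *)
rewrite -sum1_card (partition_big A_color (fun B => B \subset A)) /=; last first.
  by move=> x _; apply: A_colorS.
under eq_bigr => B BA.
  rewrite (_ : \sum_(_ in _ | _) _ = n B); last first.
    by rewrite /n -sum1_card; apply: eq_bigl => x; rewrite inE.
  over.
rewrite (bigID (fun B => a \in B)) /=.
rewrite [X in _ + X](reindex_onto (fun B => A :\: B) (fun B => A :\: B)) /=; last first.
  by move=> B /andP[BA _]; rewrite setDDr setDv set0U (setIidPr BA).
rewrite [X in _ + X](_ : _ = \sum_(B : {set V} | (B \subset A) && (a \in B)) n B).
  by rewrite addnn odd_double.
apply: eq_big => [B|B /andP[/andP[_ _] /eqP <-]]; last by rewrite nC ?subsetDl // !setDDr !setDv !set0U.
rewrite subsetDl inE aA andbT negbK /= setDDr setDv set0U.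
by rewrite andbC -(sameP setIidPr eqP).
Qed.

End DisjointBlocks.
End Blocks.

(** * Induction on the number of blocks *)

Section TightLists.
Variables (V C : finType) (e : rel V).
Hypothesis e_irr : irreflexive e.
Implicit Types (L : V -> {set C}) (A X : {set V}) (P : {set {set V}}).

Theorem not_colorable_tight L A P : #|A| = 4 -> independent e A ->
    {in P, forall X, #|X| = 2 /\ independent e X} ->
    {in A :|: cover P, forall v, #|P| < #|L v|} ->
    ~~ colorable e L (A :|: cover P) ->
  odd #|P| /\ {in A, forall a, #|L a| = #|P|.+1}.
Proof.
move=> A4 indA; have [n] := ubnP #|P|; elim: n => // n IH in L P *.
rewrite ltnS => Pn blk Lk ncol.
have [[X [c [XP cX]]]|dis] := disjoint_listsP P L; last first.
  have [evk tight] := disjoint_blocks_tight e_irr A4 indA blk erefl Lk dis ncol.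
  by split=> //; move: evk; rewrite oddS negbK.
exfalso; have [X2 indX] := blk X XP; have cardP := cardsD1 X P; rewrite XP in cardP.
have XW : X \subset A :|: cover P by rewrite subsetU // (bigcup_sup _ XP) ?orbT.
have card_del v : v \in A :|: cover P -> #|P| <= #|L v :\ c|.
  by move=> /Lk; have := cardsD1 c (L v); case: (c \in L v) => /= ->; lia.
have subW : A :|: cover (P :\ X) \subset A :|: cover P.
  by apply: setUS; apply/bigcupsP => Y /setD1P[_ YP]; apply: (bigcup_sup _ YP).
have [|Y /setD1P[_ /blk]//|v vW||_ tight] := IH (fun v => L v :\ c) (P :\ X).
- by apply: leq_trans Pn; rewrite cardP.
- by have := card_del v (subsetP subW v vW); rewrite cardP.
- apply: contra ncol => col; apply: (colorable_const XW indX cX).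
  by apply: colorableS col; apply: setUDcover.
(* By induction exactly [#|P|] colours of [L a] survive the deletion of [c], while [L a] has
   more. *)
have cA : {in A, forall a, c \in L a}.
  move=> a aA; have aW : a \in A :|: cover P by rewrite inE aA.
  have := Lk a aW; have := cardsD1 c (L a); rewrite tight //.
  by case: (c \in L a) => // ->; rewrite cardP ltnn.
move/negP: ncol; apply; apply: (colorable_const (subsetUl _ _) indA cA).
apply: (@colorableS _ _ _ _ _ (cover P)); first by rewrite setDUl setDv set0U subsetDl.
apply: (colorable_blocks e_irr c blk) => v vP.
by apply: card_del; rewrite inE vP orbT.
Qed.

End TightLists.

(** * The upper bound for K(4,2,...,2) *)

Section UpperBound.
Variable k : nat.
Hypothesis k0 : 0 < k.

Let A : {set 'I_(2 * k + 2)} := [set v | K42_part v == 0].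
Let block (i : 'I_k.-1) : {set 'I_(2 * k + 2)} := [set v | K42_part v == i.+1].
Let P := [set block i | i : 'I_k.-1].

Lemma K42_irr : irreflexive (@K42 k).
Proof. by move=> v; rewrite /K42 /complete_multipartite /= eqxx. Qed.

Lemma K42_part_independent i : independent (@K42 k) [set v | K42_part v == i].
Proof.
apply/forall_inP => u; rewrite inE => /eqP uA; apply/forall_inP => v; rewrite inE => /eqP vA.
by rewrite /K42 /complete_multipartite /= uA vA eqxx.
Qed.

Lemma K42_card_A : #|A| = 4.
Proof.
have h : 4 <= 2 * k + 2 by lia.
have -> : A = [set widen_ord h i | i : 'I_4].
  apply/setP => v; rewrite inE /K42_part; apply/eqP/imsetP => [|[i _ ->]].
    case: ifP => [v4 _|_]; last by rewrite addn1.
    by exists (Ordinal v4) => //; exact: val_inj.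
  by rewrite /= ltn_ord.
rewrite card_imset ?card_ord // => i j /(congr1 val) /= ij; exact: val_inj.
Qed.

Lemma K42_card_block i : #|block i| = 2.
Proof.
have h1 : 4 + 2 * i < 2 * k + 2 by have := ltn_ord i; lia.
have h2 : 5 + 2 * i < 2 * k + 2 by have := ltn_ord i; lia.
have -> : block i = [set Ordinal h1; Ordinal h2].
  apply/setP => v; rewrite !inE /K42_part -!val_eqE /=.
  by case: ifP => v4; lia.
by rewrite cards2 -val_eqE /=; lia.
Qed.

Lemma K42_card_P : #|P| = k.-1.
Proof.
rewrite card_imset ?card_ord // => i j ij; apply: val_inj.
have /card_gt0P[v vi] : 0 < #|block i| by rewrite K42_card_block.
by have := vi; rewrite ij; move: vi; rewrite !inE => /eqP-> /eqP[].
Qed.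

Lemma K42_cover : A :|: cover P = setT.
Proof.
apply/setP => v; rewrite in_setT in_setU; apply/orP.
case E: (K42_part v) => [|i]; [left | right]; first by rewrite inE E.
have ik : i < k.-1.
  by move: E; rewrite /K42_part; case: ifP => // v4; have := ltn_ord v; lia.
apply/bigcupP; exists (block (Ordinal ik)); last by rewrite inE E.
by apply: imset_f.
Qed.

Lemma K42_hall_property j : k <= j -> odd k || (k < j) -> hall_property (@K42 k) j.
Proof.
move=> kj okj C L _ Lj.
suff /colorableP[psi [psiL psie]] : colorable (@K42 k) L setT.
  by exists psi; split=> [v|u v]; [exact: psiL | exact: psie].
rewrite -K42_cover; apply: contraTT okj => ncol.
have blk : {in P, forall X : {set _}, #|X| = 2 /\ independent (@K42 k) X}.
  by move=> _ /imsetP[i _ ->]; split; [exact: K42_card_block | exact: K42_part_independent].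
have Lk : {in A :|: cover P, forall v, #|P| < #|L v|}.
  by move=> v _; rewrite K42_card_P prednK // (leq_trans kj).
have [+ tight] := not_colorable_tight K42_irr K42_card_A (K42_part_independent 0) blk Lk ncol.
rewrite K42_card_P; have /card_gt0P[a aA] : 0 < #|A| by rewrite K42_card_A.
have := tight a aA; rewrite K42_card_P prednK // => La.
have := Lj a; rewrite La negb_or -leqNgt => -> ; rewrite andbT.
by rewrite -{2}(prednK k0) oddS negbK.
Qed.

End UpperBound.

(** * The lower bound: lists of size [2 * h] with Hall's condition but no colouring *)

Lemma alpha_ge (T : finType) (e F : rel T) (S A I : {set T}) :
  subgraph e S F -> I \subset A -> independent e I -> #|I| <= alpha A F.
Proof.
move=> sub IA indI; have indF : independent F I.
  apply/forall_inP => x xI; apply/forall_inP => y yI; apply/negP => /sub[_ _ xy].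
  by have /forall_inP/(_ x xI)/forall_inP/(_ y yI)/negP := indI.
by apply: (bigmax_sup I); rewrite ?IA.
Qed.

Lemma hall_property_leq (T : finType) (e : rel T) i j :
  i <= j -> hall_property e i -> hall_property e j.
Proof.
by move=> ij hi C L hall Lj; apply: (hi C L hall) => v; apply: leq_trans ij (Lj v).
Qed.

Section LowerBound.
Variables k h : nat.
Hypotheses (h0 : 0 < h) (hk : 2 * h <= k).

Let V : finType := 'I_(2 * k + 2).
Let C : finType := (bool * (bool * 'I_h) + V * (bool * 'I_h))%type.

(** For [v < 4] these are the binary digits of [v]; they select the [A] half and the [B] half of its
    list. *)
Let bit (v : V) (s : bool) : bool := if s then 1 < v else odd v.

(* The pair (s, (t, i)) is the i-th colour of A_t if s is false, of B_t otherwise. *)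
Let f (v : V) (q : bool * 'I_h) : C :=
  if v < 4 then inl (q.1, (bit v q.1, q.2))
  else if v < 4 * h + 2 then inl (odd v, q)
  else inr (v, q).

Let L (v : V) : {set C} := [set f v q | q : bool * 'I_h].

Lemma bad_card v : #|L v| = 2 * h.
Proof.
rewrite card_imset ?card_prod ?card_bool ?card_ord // => -[t i] [t' i'].
by rewrite /f; case: ifP => _; [|case: ifP => _] => -[*]; subst.
Qed.

Lemma block_bound s (i : 'I_(2 * h).-1) : 4 + 2 * i + (s : bool) < 2 * k + 2.
Proof. by have := ltn_ord i; lia. Qed.

(** One vertex from each special 2-part: those with list A0 + A1 if [s] is false, B0 + B1
    otherwise. *)
Let T s : {set V} := [set Ordinal (block_bound s i) | i : 'I_(2 * h).-1].

Lemma in_T s (v : V) : (v \in T s) = (4 <= v < 4 * h + 2) && (odd v == s).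
Proof.
apply/imsetP/andP => [[i _ ->]|[vb /eqP vs]] /=.
  by have := ltn_ord i; split; lia.
have ih : (v - 4)./2 < (2 * h).-1 by lia.
by exists (Ordinal ih) => //; apply: val_inj => /=; lia.
Qed.

Lemma card_T s : #|T s| = (2 * h).-1.
Proof.
rewrite card_imset ?card_ord // => i j /(congr1 val) /= ij; apply: val_inj => /=; lia.
Qed.

Lemma T_adjacent s u v : u \in T s -> v \in T s -> u != v -> K42 u v.
Proof.
rewrite !in_T -val_eqE /K42 /complete_multipartite /= /K42_part => /andP[ub /eqP us] /andP[vb /eqP vs].
by case: ifP; case: ifP; lia.
Qed.

(** Each side's colours contribute at least [h * #|S0|], by independent sets in the big part, and at
    least [2 * h] if [S] meets [T s]; private colours pay for [S2]. These bounds just suffice when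
    [#|S0| = 2] and [S] contains both [T s]. *)
Lemma bad_hall : hall_condition (@K42 k) L.
Proof.
move=> S F sub; pose al c := alpha (restrict S L c) F.
have al1 v c : v \in S -> c \in L v -> 0 < al c.
  move=> vS cv; rewrite -(cards1 v); apply: (alpha_ge sub).
    by rewrite sub1set inE vS.
  apply/forall_inP => x /set1P->; apply/forall_inP => y /set1P->.
  by rewrite K42_irr.
pose S0 := S :&: [set v : V | v < 4].
pose S2 := S :&: [set v : V | 4 * h + 2 <= v].
have Sle : #|S| <= #|S0| + #|S :&: T false| + #|S :&: T true| + #|S2|.
  apply: leq_trans (_ : #|S0 :|: (S :&: T false) :|: (S :&: T true) :|: S2| <= _).
    apply: subset_leq_card; rewrite /S0 /S2 -!setIUr subsetI subxx /=.
    by apply/subsetP => v _; rewrite !inE !in_T; case: (odd v); lia.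
  by do 3 (apply: leq_trans (leq_card_setU _ _) _; rewrite ?leq_add2r).
have sum_split : \sum_c al c = (\sum_q al (inl (false, q)) + \sum_q al (inl (true, q))) +
    \sum_v \sum_q al (inr (v, q)).
  have pairE (I J : finType) (g : I * J -> nat) : \sum_p g p = \sum_i \sum_j g (i, j).
    by rewrite pair_bigA; apply: eq_bigr => -[].
  rewrite big_sumType /= (pairE _ _ (fun p => al (inl p))) (pairE _ _ (fun p => al (inr p))).
  by rewrite big_bool /= [X in X + _ = _]addnC.
have side s : h * #|S0| <= \sum_q al (inl (s, q)) /\
    (0 < #|S :&: T s| -> 2 * h <= \sum_q al (inl (s, q))).
  split=> [|/card_gt0P[v /setIP[vS vT]]].
    apply: leq_trans (_ : \sum_(q : bool * 'I_h) #|[set v in S0 | bit v s == q.1]| <= _).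
      rewrite -(pair_bigA _ (fun t (i : 'I_h) => #|[set v in S0 | bit v s == t]|)) /=.
      rewrite big_bool !sum_nat_const !card_ord /= -mulnDr leq_mul2l; apply/orP; right.
      rewrite -(cardsID [set v | bit v s] S0); apply: leq_add; apply: subset_leq_card;
        apply/subsetP => v; rewrite !inE; case: (bit v s); rewrite ?andbF ?andbT //.
    apply: leq_sum => -[t i] _; apply: (alpha_ge sub).
      apply/subsetP => v; rewrite !inE => /andP[/andP[-> v4] /eqP vt] /=.
      by apply/imsetP; exists (s, i) => //; rewrite /f v4 vt.
    apply/forall_inP => x; rewrite !inE => /andP[/andP[_ x4] _].
    apply/forall_inP => y; rewrite !inE => /andP[/andP[_ y4] _].
    by rewrite /K42 /complete_multipartite /= /K42_part x4 y4.
  apply: leq_trans (_ : \sum_(q : bool * 'I_h) 1 <= _).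
    by rewrite sum1_card card_prod card_bool card_ord.
  apply: leq_sum => q _; apply: (al1 v _ vS); apply/imsetP; exists q => //.
  by move: vT; rewrite in_T /f => /andP[/andP[v4 vh] /eqP <-]; rewrite ltnNge v4 /= vh.
have private : #|S2| <= \sum_v \sum_q al (inr (v, q)).
  rewrite -sum1_card big_mkcond /=; apply: leq_sum => v _.
  case: ifP => //; rewrite !inE => /andP[vS vh].
  rewrite (bigD1 (true, Ordinal h0)) //=; apply: leq_trans (leq_addr _ _).
  apply: (al1 v _ vS); apply/imsetP; exists (true, Ordinal h0) => //.
  have v4 : (v < 4) = false by clear -vh h0; lia.
  by rewrite /f v4 ltnNge vh.
have T_le s : #|S :&: T s| <= (2 * h).-1.
  by rewrite -(card_T s) subset_leq_card ?subsetIr.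
have S0_le : #|S0| <= 4.
  apply: leq_trans (subset_leq_card (subsetIr _ _)) _.
  have -> : [set v : V | v < 4] = [set v | K42_part v == 0].
    by apply/setP => v; rewrite !inE /K42_part; case: ifP => //; rewrite addn1.
  by rewrite K42_card_A //; lia.
rewrite sum_split; apply: leq_trans Sle _; rewrite leq_add // -addnA.
have := T_le false; have := T_le true; have [] := side false; have [] := side true.
move: (\sum_q al (inl (true, q))) (\sum_q al (inl (false, q))) => x y.
move: S0_le; case: #|S0| => [|[|[|[|[|n]]]]] //; clear -h0; lia.
Qed.


Lemma bad_not_colorable psi : ~ proper_L_coloring (@K42 k) L psi.
Proof.
case=> psiL psie.
(* The clique [T s] uses [2 * h - 1] of the [2 * h] colours of its side. *)
have unused s : exists q0, forall q, q != q0 -> exists2 w, w \in T s & psi w = inl (s, q).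
  pose side : {set C} := [set inl (s, q) | q : bool * 'I_h].
  have side_card : #|side| = 2 * h.
    rewrite card_imset ?card_prod ?card_bool ?card_ord // => q q' []; exact.
  have used : psi @: T s \subset side.
    apply/subsetP => _ /imsetP[v vT ->]; have /imsetP[q _ ->] := psiL v.
    move: vT; rewrite in_T /f => /andP[/andP[v4 vh] /eqP vs].
    by rewrite ltnNge v4 /= vh vs; apply: imset_f.
  have : #|side :\: psi @: T s| == 1.
    rewrite cardsD (setIidPr used) side_card card_in_imset ?card_T; first by lia.
    move=> u v uT vT; apply: contra_eq => uv; apply: psie; exact: T_adjacent uT vT uv.
  case/cards1P => c rem; have : c \in side :\: psi @: T s by rewrite rem inE.
  case/setDP => /imsetP[q0 _ cq] _; exists q0 => q qq0.
  have : inl (s, q) \notin side :\: psi @: T s.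
    by rewrite rem inE cq; apply: contra qq0 => /eqP[->].
  rewrite inE negb_and negbK => /orP[/imsetP[w wT ->]|]; first by exists w.
  by rewrite imset_f.
have [qF usedF] := unused false; have [qT usedT] := unused true.
have ab : ~~ qF.1 + 2 * ~~ qT.1 < 2 * k + 2 by case: qF.1; case: qT.1 => /=; lia.
pose a : V := Ordinal ab.
have a4 : a < 4 by rewrite /a /=; case: qF.1; case: qT.1.
have bitF : bit a false = ~~ qF.1 by rewrite /bit /a /=; case: qF.1; case: qT.1.
have bitT : bit a true = ~~ qT.1 by rewrite /bit /a /=; case: qF.1; case: qT.1.
have [[s i] _ E] := imsetP (psiL a); rewrite /f a4 /= in E.
have [w wT ww] : exists2 w, w \in T s & psi w = psi a.
  rewrite E; case: (s); [apply: usedT | apply: usedF]; rewrite ?bitT ?bitF.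
    by case: (qT) => [[] ?].
  by case: (qF) => [[] ?].
have /negP[] : psi w != psi a; last by rewrite ww.
apply: psie; move: wT; rewrite in_T /K42 /complete_multipartite /= /K42_part a4.
by case: ifP; lia.
Qed.

End LowerBound.

Unset Implicit Arguments.

Theorem theorem4 (k : nat) :
  2 <= k -> @hall_number_is _ (@K42 k) (if odd k then k else k.+1).
Proof.
move=> k2; have k0 : 0 < k by apply: ltnW.
split; first by case: ifP.
  by apply: K42_hall_property => //; case: (odd k); rewrite /= ?leqnn ?leqnSn.
(* [2 * k./2] is [k - 1] for odd [k] and [k] for even [k], the largest [j] to exclude. *)
move=> j _ jlt hj; have hk : 2 * k./2 <= k by lia.
have jk : j <= 2 * k./2 by move: jlt; case: ifP; lia.
have h0 : 0 < k./2 by lia.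
have [|psi] := hall_property_leq jk hj (bad_hall h0 hk).
  by move=> v; rewrite bad_card.
exact: bad_not_colorable.
Qed.
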